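(* Let $G_1=(V_1,E_1)$ and $G_2=(V_2,E_2)$ be connected finite simple graphs with disjoint vertex sets, each containing at least one edge, with $|V_i|=n_i$ for $i=1,2$, and set $$B=\left\lceil\frac{n_1n_2}{n_1+n_2-1}\right\rceil-1.$$ Then $$\max\{\operatorname{gscat}(G_1),\operatorname{gscat}(G_2),B\}\leq\operatorname{gscat}(G_1* G_2)\leq\operatorname{gscat}(G_1)+\operatorname{gscat}(G_2)+B+1,$$ where $G_1*G_2$ is the (graph) join of $G_1$ and $G_2$ and $\operatorname{gscat}$ denotes the simplicial geometric category.
   Context: All graphs are finite and simple; all simplicial complexes are finite abstract simplicial complexes. A graph is regarded as a simplicial complex of dimension at most one (its vertices and edges being the simplices) whenever $\operatorname{gscat}$ is applied to it; in particular $G_1*G_2$ below is a graph, regarded as a one-dimensional complex. Join: for graphs $G_1=(V_1,E_1)$ and $G_2=(V_2,E_2)$ with disjoint vertex sets, the join $G_1*G_2$ is the graph with vertex set $V_1\cup V_2$ and edge set $E_1\cup E_2\cup\{uv: u\in V_1,\ v\in V_2\}$. Strong collapse: let $K$ be a simplicial complex and $u\neq v$ vertices of $K$. The vertex $v$ is dominated by $u$ if every maximal simplex of $K$ containing $v$ also contains $u$. In this case, deleting $v$ together with all simplices containing it is called an elementary strong collapse. A strong collapse is a finite sequence of elementary strong collapses. $K$ is strongly collapsible if it strongly collapses to a single vertex (a single vertex is itself strongly collapsible). Simplicial geometric category: $\operatorname{gscat}(K)$ is the least integer $m\geq 0$ such that $K=C_0\cup C_1\cup\cdots\cup C_m$,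 where each $C_i$ is a strongly collapsible subcomplex of $K$. *)

(* Defs.v *)
From mathcomp Require Import all_boot.

Set Implicit Arguments.
Unset Strict Implicit.
Unset Printing Implicit Defensive.

Section SimplicialComplexes.

Variable T : finType.
Implicit Types (K L C : {set {set T}}) (s t : {set T}) (u v : T).

(* Simplices are nonempty: set0 is never a member of a complex. The vertices  *)
(* of K are the v with [set v] \in K, so a complex (in particular, a          *)
(* subcomplex) need not use all the elements of T.                            *)
Definition simplicial_complex K : bool :=
  (set0 \notin K) &&
  [forall s in K, forall t : {set T}, (t \subset s) && (t != set0) ==> (t \in K)].

Definition subcomplex C K : bool := simplicial_complex C && (C \subset K).

Definition dominated K v u : bool :=
  [&& [set u] \in K, [set v] \in K, u != v &
      [forall s : {set T}, maxset (mem K) s && (v \in s) ==> (u \in s)]].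

Definition del_vertex K v : {set {set T}} := [set s in K | v \notin s].

Definition elementary_strong_collapse : rel {set {set T}} :=
  fun K L => [exists v, [exists u, dominated K v u] && (L == del_vertex K v)].

Definition strongly_collapses : rel {set {set T}} :=
  connect elementary_strong_collapse.

Definition strongly_collapsible K : bool :=
  [exists v, strongly_collapses K [set [set v]]].

Definition gscat_cover K (m : nat) : bool :=
  [exists C : {ffun 'I_m.+1 -> {set {set T}}},
    [forall i, subcomplex (C i) K && strongly_collapsible (C i)]
    && (K == \bigcup_i C i)].

Definition closed_simplex s : {set {set T}} := powerset s :\ set0.

Lemma closed_simplex_complex s : simplicial_complex (closed_simplex s).
Proof.
rewrite /simplicial_complex !inE eqxx /=.
apply/forall_inP => t; rewrite !inE => /andP[_ ts].
apply/forallP => r; apply/implyP => /andP[rt r0].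
by rewrite !inE r0 (subset_trans rt ts).
Qed.

Lemma closed_simplex_collapsible s :
  s != set0 -> strongly_collapsible (closed_simplex s).
Proof.
have [n le_n] := ubnP #|s|; elim: n s le_n => // n IHn s le_n /set0Pn[u us].
have [s'0|/set0Pn[v]] := eqVneq (s :\ u) set0.
  have -> : closed_simplex s = [set [set u]].
    have -> : s = [set u] by rewrite -(setD1K us) s'0 setU0.
    apply/setP => t; rewrite !inE subset1.
    by case: (eqVneq t set0) => [->|] /=; rewrite ?orbF // eq_sym -cards_eq0 cards1.
  by apply/existsP; exists u; apply: connect0.
rewrite !inE => /andP[vu vs].
have us' : u \in s :\ v by rewrite !inE eq_sym vu.
have /existsP[w hw] : strongly_collapsible (closed_simplex (s :\ v)).
  apply: IHn; last by apply/set0Pn; exists u.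
  by move: le_n; rewrite (cardsD1 v s) vs.
have ne1 (x : T) : [set x] != set0 by rewrite -cards_eq0 cards1.
apply/existsP; exists w; apply: connect_trans hw; apply: connect1.
apply/existsP; exists v; apply/andP; split; last first.
  by apply/eqP/setP => t; rewrite !inE subsetD1 !andbA.
apply/existsP; exists u; apply/and4P; split; rewrite ?inE ?ne1 ?sub1set //.
  by rewrite eq_sym.
apply/forallP => t; apply/implyP => /andP[/maxsetP[tK tmax] _].
move: tK; rewrite !inE => /andP[_ ts].
suff <- : s = t by [].
apply: tmax => //; rewrite /= !inE subxx andbT.
by apply/set0Pn; exists u.
Qed.

Lemma gscat_cover_exists K :
  exists m, simplicial_complex K && (K != set0) ==> gscat_cover K m.
Proof.
have [->|/set0Pn[s0 s0K]] := eqVneq K set0; first by exists 0; rewrite andbF.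
exists #|K|.-1; apply/implyP => /andP[/andP[K0 /forall_inP Kdown] _].
have Kgt0 : 0 < #|K| by rewrite (cardD1 s0) s0K.
have sK i : nth s0 (enum K) i \in K.
  have [lt_i|ge_i] := ltnP i (size (enum K)); last by rewrite nth_default.
  by rewrite -mem_enum mem_nth.
apply/existsP; exists [ffun i : 'I__ => closed_simplex (nth s0 (enum K) i)].
have sub i t : t \in closed_simplex (nth s0 (enum K) i) -> t \in K.
  rewrite !inE => /andP[t0 ts].
  by move/forallP/(_ t)/implyP: (Kdown _ (sK i)); apply; rewrite ts t0.
apply/andP; split.
  apply/forallP => i; rewrite ffunE closed_simplex_collapsible; last first.
    by apply: contraNneq K0 => <-.
  rewrite /subcomplex closed_simplex_complex andbT /=.
  by apply/subsetP => t; apply: sub.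
apply/eqP/setP => t; apply/idP/bigcupP => [tK|[i _]]; last first.
  by rewrite ffunE; apply: sub.
have lt_t : index t (enum K) < #|K|.-1.+1.
  by rewrite prednK // cardE index_mem mem_enum.
exists (Ordinal lt_t) => //; rewrite ffunE nth_index ?mem_enum //.
by rewrite !inE subxx andbT; apply: contraNneq K0 => <-.
Qed.

(* The hypothesis inside gscat_cover_exists only makes gscat total: it is the *)
(* least m such that gscat_cover K m when K is a nonempty complex, and has    *)
(* the junk value 0 otherwise (the empty complex has no such cover).          *)
Definition gscat K : nat := ex_minn (gscat_cover_exists K).

Lemma gscatP K : simplicial_complex K -> K != set0 ->
  gscat_cover K (gscat K) /\ forall m, gscat_cover K m -> gscat K <= m.
Proof.
move=> cK K0; rewrite /gscat; case: ex_minnP => m; rewrite cK K0 => mK mmin.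
by split=> // k kK; apply: mmin.
Qed.

End SimplicialComplexes.

Record sgraph := SGraph {
  vertex :> finType;
  adj : rel vertex;
  adj_sym : symmetric adj;
  adj_irrefl : irreflexive adj }.

Definition graph_complex (G : sgraph) : {set {set G}} :=
  [set [set x] | x : G] :|: [set [set p.1; p.2] | p : G * G & adj p.1 p.2].

Lemma graph_complex_simplicial (G : sgraph) :
  simplicial_complex (graph_complex G).
Proof.
have v1 (x : G) : [set x] \in graph_complex G by rewrite inE imset_f.
apply/andP; split.
  rewrite inE negb_or; apply/andP; split; apply/imsetP => -[x _ /esym/eqP].
    by rewrite -cards_eq0 cards1.
  by rewrite -cards_eq0 cards2.
apply/forall_inP => s sK; apply/forallP => t; apply/implyP => /andP[ts t0].
have [->//|neq_ts] := eqVneq t s.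
have: #|t| < #|s| by apply: proper_card; rewrite properEneq neq_ts.
have: 0 < #|t| by rewrite card_gt0.
have le2 : #|s| <= 2.
  by move: sK; rewrite inE => /orP[]/imsetP[x _ ->]; rewrite ?cards1 ?cards2 // ltnS leq_b1.
move=> t_gt0 lt_ts.
have /cards1P[x ->] : #|t| == 1 by rewrite eqn_leq t_gt0 andbT -ltnS (leq_trans lt_ts).
exact: v1.
Qed.

(* The graph complex of a graph with a vertex is nonempty, so that gscat does *)
(* not take its junk value there.                                             *)
Lemma graph_complex_neq0 (G : sgraph) (x : G) : graph_complex G != set0.
Proof. by apply/set0Pn; exists [set x]; rewrite inE imset_f. Qed.

Definition connected_graph (G : sgraph) : Prop :=
  0 < #|G| /\ forall x y : G, connect (@adj G) x y.

Definition has_edge (G : sgraph) : Prop := exists x y : G, adj x y.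

Section Join.

Variables G1 G2 : sgraph.

Definition join_adj : rel (G1 + G2)%type := fun a b =>
  match a, b with
  | inl x, inl y => adj x y
  | inr x, inr y => adj x y
  | _, _ => true
  end.

Lemma join_adj_sym : symmetric join_adj.
Proof. by move=> [x|x] [y|y] //=; apply: adj_sym. Qed.

Lemma join_adj_irrefl : irreflexive join_adj.
Proof. by move=> [x|x] /=; apply: adj_irrefl. Qed.

(* The sum type makes the two vertex sets disjoint. *)
Definition graph_join : sgraph := SGraph join_adj_sym join_adj_irrefl.

End Join.

(* Main.v *)
Require Import Defs.
From mathcomp Require Import all_boot all_order all_algebra.
From mathcomp Require Import zify.

(* Strongly collapsible subcomplexes of a graph are its subtrees, and in a
   connected graph every forest extends to a spanning tree, so gscat + 1 is the
   arboricity.  Forests of G1 * G2 restrict to forests of each factor and have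
   at most n1 + n2 - 1 edges, whence the lower bound.  For the upper bound, a
   forest of G1 and one of G2 are disjoint, so max(a1, a2) <= a1 + a2 - 1
   forests cover both graphs; the n1 n2 remaining edges split into k forests as
   soon as k <= n1 and n1 n2 <= k (n1 + n2 - 1).  To see the latter, write
   t e = ceil(e n1 / k).  In column j, class c takes the cyclic interval of
   rows [t (c + j) - j, t (c + j + 1) - j - 1].  For fixed j these intervals
   partition the rows; for fixed c each one starts at the row where the previous
   one ended, and t (c + n2) - t c <= n1 + n2 - 1 says that this staircase does
   not wrap around, so that it is acyclic. *)

Set Implicit Arguments.
Unset Strict Implicit.
Unset Printing Implicit Defensive.

(** * Sparse families of edges *)

Section Sparse.

Variable T : finType.
Implicit Types (F C : {set {set T}}) (S s : {set T}) (u v : T).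

Definition two_uniform F := forall s, s \in F -> #|s| = 2.

Definition edges_in F S : {set {set T}} := [set s in F | s \subset S].

Definition edges_at F S v : {set {set T}} := [set s in edges_in F S | v \in s].

Definition edge_count F S : nat := #|edges_in F S|.

Definition degree F S v : nat := #|edges_at F S v|.

(* For a graph, being sparse is equivalent to being acyclic. *)
Definition sparse F : bool :=
  [forall S : {set T}, (S != set0) ==> (edge_count F S < #|S|)].

(** For sparse [F] this count is the largest possible; it says that [F] induces a tree on [S]. *)
Definition tight F S : bool := (S != set0) && (edge_count F S == #|S|.-1).

Lemma sparseP F :
  reflect (forall S, S != set0 -> edge_count F S < #|S|) (sparse F).
Proof.
by apply: (iffP forallP) => H S; [apply/implyP/H | apply/implyP/H].
Qed.

Lemma edge_countD1 F S v :
  edge_count F S = degree F S v + edge_count F (S :\ v).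
Proof.
rewrite /edge_count -(cardsID [set s : {set T} | v \in s] (edges_in F S)).
congr (_ + _); apply: eq_card => s; rewrite !inE ?subsetD1 //.
by rewrite andbC -andbA.
Qed.

Lemma sparse_set0 : sparse set0.
Proof.
apply/sparseP => S; rewrite -card_gt0; suff : edges_in set0 S == set0.
  by rewrite -cards_eq0 -/(edge_count _ _) => /eqP->.
by apply/eqP/setP => s; rewrite !inE.
Qed.

Lemma edges_in_small F S : two_uniform F -> #|S| < 2 -> edges_in F S = set0.
Proof.
move=> F2 S2; apply/setP => s; rewrite !inE; apply/negP => /andP[/F2 s2].
by move=> /subset_leq_card; rewrite s2 leqNgt S2.
Qed.

Lemma edge_count_small F S : two_uniform F -> #|S| < 2 -> edge_count F S = 0.
Proof. by move=> F2 S2; rewrite /edge_count edges_in_small ?cards0. Qed.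

(** Peeling off such a vertex [v] loses one vertex and at most one edge, so the bound for [S :\ v]
    gives the bound for [S]. *)
Lemma sparse_degree F : two_uniform F ->
  (forall S, S != set0 -> exists2 v, v \in S & degree F S v <= 1) -> sparse F.
Proof.
move=> F2 deg; apply/sparseP => S; have [n] := ubnP #|S|.
elim: n S => // n IHn S leS S0; have [v vS dv] := deg S S0.
have cS : #|S| = #|S :\ v|.+1 by rewrite (cardsD1 v S) vS.
have [S1|S1] := eqVneq (S :\ v) set0.
  by rewrite edge_count_small // cS S1 cards0.
have := IHn (S :\ v) _ S1; rewrite (edge_countD1 F S v); lia.
Qed.

Lemma sum_degrees F S : two_uniform F ->
  \sum_(v in S) degree F S v = (edge_count F S).*2.
Proof.
move=> F2; transitivity (\sum_(v in S) \sum_(s in edges_in F S | v \in s) 1).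
  by apply: eq_bigr => v vS; rewrite sum1dep_card; apply: eq_card => s; rewrite !inE.
rewrite (exchange_big_dep (mem (edges_in F S))) /=; last by move=> v s _ /andP[].
rewrite -muln2 -sum_nat_const; apply: eq_bigr => s sFS.
case/setIdP: sFS => sF /subsetP sS; rewrite -(F2 s sF) sum1dep_card.
apply: eq_card => v; rewrite !inE; apply/and3P/idP => [[]//|vs].
by rewrite sF; split; [apply: sS | apply/subsetP |].
Qed.

(** Were all degrees at least 2, the handshake identity would give at least [#|S|] edges. A vertex
    of degree 0 would leave all [#|S|.-1] edges on [S :\ v], against sparsity. *)
Lemma leaf_exists F S : two_uniform F -> sparse F -> tight F S -> 1 < #|S| ->
  exists2 v, v \in S & (degree F S v == 1) && tight F (S :\ v).
Proof.
move=> F2 /sparseP spF /andP[S0 /eqP eS] S1.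
have [/existsP[v /andP[vS dv]]|] := boolP [exists v in S, degree F S v <= 1]; last first.
  rewrite negb_exists_in => /forall_inP deg; have := sum_degrees S F2.
  suff: \sum_(v in S) 2 <= \sum_(v in S) degree F S v.
    by rewrite sum_nat_const; lia.
  by apply: leq_sum => v /deg; rewrite -ltnNge.
exists v => //; have cS := cardsD1 v S; rewrite vS add1n in cS.
have S'0 : S :\ v != set0 by rewrite -card_gt0; lia.
have := edge_countD1 F S v; have := spF _ S'0.
rewrite /tight S'0 /=; lia.
Qed.

(** * Pruning leaves as strong collapses *)

Definition spanned_complex F S : {set {set T}} :=
  [set [set v] | v in S] :|: edges_in F S.

Lemma spanned_complex_simplicial F S : two_uniform F ->
  simplicial_complex (spanned_complex F S).
Proof.
move=> F2; have card_s s : s \in spanned_complex F S -> 0 < #|s| <= 2.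
  by rewrite inE => /orP[/imsetP[v _ ->]|/setIdP[/F2->]]; rewrite ?cards1.
have sub_s s : s \in spanned_complex F S -> s \subset S.
  by rewrite inE => /orP[/imsetP[v vS ->]|/setIdP[]]; rewrite ?sub1set.
apply/andP; split; first by apply/negP => /card_s; rewrite cards0.
apply/forall_inP => s sK; apply/forallP => t; apply/implyP => /andP[ts t0].
have [->//|neq_ts] := eqVneq t s.
have: #|t| < #|s| by apply: proper_card; rewrite properEneq neq_ts.
rewrite -card_gt0 in t0 => lt_ts; have /andP[_ s2] := card_s s sK.
have /cards1P[x tx] : #|t| == 1.
  by rewrite eqn_leq t0 andbT -ltnS (leq_trans lt_ts).
rewrite inE tx imset_f //.
by rewrite -sub1set -tx (subset_trans ts) ?sub_s.
Qed.

Lemma two_uniform_pair F s v u : two_uniform F -> s \in F -> u != v -> v \in s -> u \in s ->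
  s = [set v; u].
Proof.
move=> F2 /F2 s2 uv vs us; apply/esym/eqP; rewrite eqEcard s2 cards2 eq_sym uv.
by rewrite andbT; apply/subsetP => x; rewrite !inE => /orP[]/eqP->.
Qed.

(** The leaf [v] is dominated by its only neighbour, since the edge joining them is the one maximal
    simplex at [v]. *)
Lemma spanned_collapse F S v : two_uniform F -> v \in S ->
  degree F S v = 1 ->
  elementary_strong_collapse (spanned_complex F S) (spanned_complex F (S :\ v)).
Proof.
move=> F2 vS /eqP/cards1P[s0 Es0].
have : s0 \in edges_at F S v by rewrite Es0 set11.
case/setIdP => /[dup] s0S /setIdP[s0F s0sub] vs0.
have /cards1P[u Eu] : #|s0 :\ v| == 1.
  by have := F2 _ s0F; rewrite (cardsD1 v) vs0; lia.
have: u \in s0 :\ v by rewrite Eu set11.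
rewrite !inE => /andP[uv us0]; have uS := subsetP s0sub u us0.
apply/existsP; exists v; apply/andP; split.
  apply/existsP; exists u; apply/and4P; split => //.
  - by rewrite inE imset_f.
  - by rewrite inE imset_f.
  apply/forallP => s; apply/implyP => /andP[/maxsetP[sK smax] vs].
  move: sK; rewrite /= inE => /orP[/imsetP[w _ sw]|sS].
    (* A singleton containing [v] lies inside the edge [s0], so its maximality would force
       [s0 = s]. *)
    have wv : w = v by apply/eqP; move: vs; rewrite sw inE eq_sym.
    suff <- : s0 = s by [].
    apply: smax; first by rewrite /= inE s0S orbT.
    by rewrite sw wv sub1set.
  have : s \in edges_at F S v by apply/setIdP.
  by rewrite Es0 => /set1P->.
apply/eqP/setP => s; rewrite !inE subsetD1 andb_orl -andbA; congr (_ || _).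
apply/imsetP/andP => [[w]|[/imsetP[w wS ->]]].
  by rewrite !inE => /andP[wv wS] ->; rewrite imset_f // inE eq_sym.
by rewrite inE => vw; exists w; rewrite // !inE eq_sym vw.
Qed.

Lemma tight_collapsible F S : two_uniform F -> sparse F -> tight F S ->
  strongly_collapsible (spanned_complex F S).
Proof.
move=> F2 spF; have [n] := ubnP #|S|; elim: n S => // n IHn S leS tS.
have [S1|S1] := leqP #|S| 1.
  have /cards1P[v Sv] : #|S| == 1 by rewrite eqn_leq S1 card_gt0; case/andP: tS.
  apply/existsP; exists v; rewrite /spanned_complex edges_in_small // setU0 Sv.
  by rewrite imset_set1; apply: connect0.
have [v vS /andP[/eqP dv tSv]] := leaf_exists F2 spF tS S1.
have /existsP[w cw] : strongly_collapsible (spanned_complex F (S :\ v)).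
  by apply: IHn => //; move: leS; rewrite (cardsD1 v S) vS.
apply/existsP; exists w; apply: connect_trans cw; apply: connect1.
exact: spanned_collapse.
Qed.

(** * Sparsity of strongly collapsible complexes of dimension at most one *)

Definition edges_of C : {set {set T}} := [set s in C | #|s| == 2].

Lemma edges_of_two_uniform C : two_uniform (edges_of C).
Proof. by move=> s /setIdP[_ /eqP]. Qed.

(** With no simplex larger than an edge, every edge at [v] is maximal, hence contains [u] and equals
    [[set v; u]]. *)
Lemma dominated_degree C S v u : (forall s, s \in C -> #|s| <= 2) ->
  dominated C v u -> degree (edges_of C) S v <= 1.
Proof.
move=> C2 /and4P[_ _ uv /forallP dom].
apply: (@leq_trans #|[set [set v; u]]|); last by rewrite cards1.
apply/subset_leq_card/subsetP => s /setIdP[/setIdP[sE _] vs]; rewrite inE; apply/eqP.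
apply: (two_uniform_pair (@edges_of_two_uniform C) sE uv vs).
move/implyP: (dom s); apply; rewrite vs andbT.
case/setIdP: sE => sC /eqP s2; apply/maxsetP; split=> // t /C2 t2 st.
by apply/esym/eqP; rewrite eqEcard st s2.
Qed.

(** Restoring [v] adds one vertex and at most one edge to a set containing it. *)
Lemma sparse_dominated C v u : (forall s, s \in C -> #|s| <= 2) ->
  dominated C v u -> sparse (edges_of (del_vertex C v)) -> sparse (edges_of C).
Proof.
move=> C2 dom /sparseP sp; apply/sparseP => S S0.
have [vS|vS] := boolP (v \in S); last first.
  suff <- : edge_count (edges_of (del_vertex C v)) S = edge_count (edges_of C) S.
    exact: sp.
  apply: eq_card => s; rewrite !inE; case: (boolP (s \subset S)) => sS; rewrite ?andbF ?andbT //.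
  suff -> : v \notin s by rewrite andbT.
  by apply: contra vS; apply: (subsetP sS).
have cS := cardsD1 v S; rewrite vS add1n in cS.
have [S'0|S'0] := eqVneq (S :\ v) set0.
  rewrite edge_count_small ?cS //; first exact: edges_of_two_uniform.
  by rewrite S'0 cards0.
rewrite (edge_countD1 _ S v); have := dominated_degree S C2 dom.
have := sp _ S'0.
suff -> : edge_count (edges_of (del_vertex C v)) (S :\ v) =
  edge_count (edges_of C) (S :\ v) by lia.
apply: eq_card => s; rewrite !inE subsetD1.
by case: (v \notin s); rewrite ?andbF ?andbT.
Qed.

(** The collapse is read backwards from its final vertex, which carries no edge. *)
Lemma collapsible_sparse C : (forall s, s \in C -> #|s| <= 2) ->
  strongly_collapsible C -> sparse (edges_of C).
Proof.
move=> C2 /existsP[w /connectP[p]].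
elim: p C C2 => [|D p IHp] C C2 /= => [_ <-|/andP[/existsP[v /andP[/existsP[u dom] /eqP DE]] pD] wp].
  apply/sparseP => S; rewrite -card_gt0; suff : edges_in (edges_of [set [set w]]) S == set0.
    by rewrite -cards_eq0 -/(edge_count _ _) => /eqP->.
  by apply/eqP/setP => s; rewrite !inE; case: eqP => // ->; rewrite cards1.
apply: (sparse_dominated C2 dom); rewrite -DE; apply: IHp => // s.
by rewrite DE => /setIdP[/C2].
Qed.

(** * Unions of tight sets *)

Lemma edge_count_supermodular F S S' :
  edge_count F S + edge_count F S' <=
    edge_count F (S :|: S') + edge_count F (S :&: S').
Proof.
rewrite /edge_count -cardsUI leq_add //; last first.
  by apply/subset_leq_card/subsetP => s; rewrite !inE subsetI; case: (s \in F).
apply/subset_leq_card/subsetP => s; rewrite !inE -andb_orr => /andP[-> /=].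
by case/orP => sS; rewrite (subset_trans sS) ?subsetUl ?subsetUr.
Qed.

(** Supermodularity, with sparsity on the intersection, leaves at least
    [#|S| + #|S'| - 2 - (#|S :&: S'| - 1)] edges on the union, which is one less than its size. *)
Lemma tight_setU F S S' : sparse F -> tight F S -> tight F S' ->
  S :&: S' != set0 -> tight F (S :|: S').
Proof.
move=> /sparseP spF /andP[S0 /eqP eS] /andP[S'0 /eqP eS'] SS'.
have SU : S :|: S' != set0 by apply: contraNneq S0 => /eqP; rewrite setU_eq0 => /andP[].
have := spF _ SS'; have := spF _ SU; rewrite /tight SU /=.
have := cardsUI S S'; have := edge_count_supermodular F S S'.
move: S0 S'0 SS'; rewrite -!card_gt0; lia.
Qed.

End Sparse.

(** * Arboricity and gscat *)

Section Graphs.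

Variable G : sgraph.
Implicit Types (F : {set {set G}}) (S : {set G}).

Definition edge_set : {set {set G}} :=
  [set [set p.1; p.2] | p : G * G & adj p.1 p.2].

Lemma edge_setP s :
  reflect (exists x y : G, adj x y /\ s = [set x; y]) (s \in edge_set).
Proof.
apply: (iffP imsetP) => [[[x y] xy ->]|[x [y [xy ->]]]]; last by exists (x, y); rewrite ?inE.
by exists x, y; move: xy; rewrite inE.
Qed.

Lemma adj_neq (x y : G) : adj x y -> x != y.
Proof. by apply: contraTneq => ->; rewrite adj_irrefl. Qed.

Lemma edge_set_two_uniform F : F \subset edge_set -> two_uniform F.
Proof.
move=> /subsetP FE s /FE /edge_setP[x [y [/adj_neq xy ->]]].
by rewrite cards2 xy.
Qed.

Definition forest F := (F \subset edge_set) && sparse F.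

(** Forests are required at every index, even beyond [k], so that covers of different lengths can be
    merged index by index. *)
Definition forest_cover (k : nat) := exists F : nat -> {set {set G}},
  (forall i, forest (F i)) /\
  (forall s, s \in edge_set -> exists2 i, i < k & s \in F i).

Lemma edge_count_pair F x y : F \subset edge_set -> x != y ->
  [set x; y] \in F -> edge_count F [set x; y] = 1.
Proof.
move=> FE xy xyF; apply/eqP/cards1P; exists [set x; y]; apply/setP => s.
rewrite !inE; apply/andP/eqP => [[sF sxy]|->//].
by apply/eqP; rewrite eqEcard sxy (edge_set_two_uniform FE sF) cards2 xy.
Qed.

(** The ends of an edge of [F] form a tight set. Adding any other edge breaks sparsity on some [S];
    as [F] alone is sparse, that edge lies in [S] and [F] was already tight there. *)
Lemma max_forest_tight_edge F x y : maxset forest F -> adj x y ->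
  exists S, [/\ tight F S, x \in S & y \in S].
Proof.
move=> /maxsetP[/andP[FE spF] Fmax] xy; have nxy := adj_neq xy.
set e := [set x; y]; have eE : e \in edge_set by apply/edge_setP; exists x, y.
have [eF|eF] := boolP (e \in F).
  exists e; rewrite !inE !eqxx orbT; split=> //.
  rewrite /tight edge_count_pair // cards2 nxy andbT.
  by apply/set0Pn; exists x; rewrite !inE eqxx.
have: ~~ sparse (e |: F).
  apply: contra eF => sp; rewrite -(Fmax (e |: F)) ?setU11 ?subsetUr //.
  by rewrite /forest sp subUset sub1set eE FE.
rewrite negb_forall => /existsP[S]; rewrite negb_imply -leqNgt => /andP[S0 leS].
exists S; have := sparseP _ spF S S0.
have eIn : edges_in (e |: F) S = (if e \subset S then e |: edges_in F S else edges_in F S).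
  apply/setP => s; case: ifP => eS; rewrite !inE; first by case: eqP => // ->.
  by case: eqP => // ->; rewrite eS ?andbF.
move: leS; rewrite {1}/edge_count eIn; case: ifP => eS; last by rewrite leqNgt => /negbTE->.
rewrite cardsU1.
have := leq_b1 (e \notin edges_in F S).
rewrite -/(edge_count F S) => ne1 leS ltS; split.
- by rewrite /tight S0 /=; lia.
- by rewrite (subsetP eS) // !inE eqxx.
- by rewrite (subsetP eS) // !inE eqxx orbT.
Qed.

(** A maximal tight set containing [x0] absorbs, by [tight_setU], the tight set around each edge it
    meets, so it is closed under adjacency. Maximal forests are thus spanning trees. *)
Lemma max_forest_tight F : connected_graph G -> maxset forest F ->
  tight F [set: G].
Proof.
move=> [/card_gt0P[x0 _] conG] Fmax.
have [FE spF] : F \subset edge_set /\ sparse F by case/maxsetP: Fmax => /andP[].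
have t0 : tight F [set x0].
  rewrite /tight edge_count_small ?cards1 ?eqxx //; last exact: edge_set_two_uniform.
  by rewrite -card_gt0 cards1.
have [S /maxsetP[tS Smax] x0S] := maxset_exists t0.
rewrite sub1set in x0S.
suff -> : [set: G] = S by [].
apply/esym/eqP; rewrite -subTset; apply/subsetP => y _.
have: closed (@adj G) (mem S).
  apply: (intro_closed (sym_connect_sym (@adj_sym G))) => a b ab aS /=.
  have [S' [tS' aS' bS']] := max_forest_tight_edge Fmax ab.
  rewrite -(Smax (S :|: S')) ?subsetUl ?inE ?bS' ?orbT //.
  by apply: tight_setU => //; apply/set0Pn; exists a; rewrite inE aS.
by move=> /closed_connect/(_ x0 y (conG x0 y)) /= <-.
Qed.

Lemma gscat_cover_forest_cover m :
  gscat_cover (graph_complex G) m -> forest_cover m.+1.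
Proof.
case/existsP => C /andP[/forallP CP /eqP covC].
(* Indices past [m] receive the empty forest. *)
exists (fun i => if insub i is Some j then edges_of (C j) else set0).
have C_E j : edges_of (C j) \subset edge_set.
  have /andP[/andP[_ /subsetP CG] _] := CP j.
  apply/subsetP => s /setIdP[/CG]; rewrite inE => /orP[|//].
  by case/imsetP => x _ ->; rewrite cards1.
split=> [i|s sE].
  case: insubP => [j _ _|_]; last by rewrite /forest sub0set sparse_set0.
  rewrite /forest C_E /=; have /andP[/andP[_ /subsetP CG] col] := CP j.
  apply: collapsible_sparse col => s /CG; rewrite inE => /orP[]/imsetP[x _ ->].
    by rewrite cards1.
  by rewrite cards2; case: (_ == _).
have: s \in graph_complex G by rewrite inE -[X in _ || X]/(s \in edge_set) sE orbT.
rewrite covC => /bigcupP[j _ sC]; exists j => //.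
by rewrite valK inE sC (edge_set_two_uniform (subxx _) sE).
Qed.

(** Each forest is enlarged to a spanning tree, whose complex is strongly collapsible by leaf
    pruning. *)
Lemma forest_cover_gscat_cover m : connected_graph G ->
  forest_cover m.+1 -> gscat_cover (graph_complex G) m.
Proof.
move=> conG [F [forF covF]].
have /fin_all_exists[M MP] (i : 'I_m.+1) : exists M, maxset forest M && (F i \subset M).
  by have [M maxM FM] := maxset_exists (forF i); exists M; rewrite maxM.
have tM i : tight (M i) [set: G] by case/andP: (MP i) => /(max_forest_tight conG).
have [M2 ME spM] : [/\ forall i, two_uniform (M i), forall i, M i \subset edge_set & forall i, sparse (M i)].
  by split=> i; have /andP[/maxsetP[/andP[ME spM] _] _] := MP i => //; apply: edge_set_two_uniform.
apply/existsP; exists [ffun i => spanned_complex (M i) [set: G]].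
have subK i : spanned_complex (M i) [set: G] \subset graph_complex G.
  apply: setUSS; last first.
    by apply/subsetP => s /setIdP[/(subsetP (ME i))].
  by apply/subsetP => s /imsetP[x _ ->]; apply: imset_f.
apply/andP; split.
  apply/forallP => i; rewrite ffunE /subcomplex subK spanned_complex_simplicial //.
  exact: tight_collapsible.
apply/eqP/setP => s; apply/idP/bigcupP => [|[i _]]; last first.
  by rewrite ffunE; apply/subsetP.
rewrite inE => /orP[/imsetP[x _ ->]|sE].
  (* A spanning tree contains every vertex, so the first one already covers [x]. *)
  by exists ord0 => //; rewrite ffunE inE imset_f.
have [i im sF] := covF s sE; exists (Ordinal im) => //; rewrite ffunE !inE subsetT.
by have /andP[_ /subsetP->] := MP (Ordinal im); rewrite ?orbT.
Qed.

Lemma forest_cover_gscat : connected_graph G ->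
  forest_cover (gscat (graph_complex G)).+1.
Proof.
move=> [/card_gt0P[x _] _]; apply: gscat_cover_forest_cover.
by have [] := gscatP (graph_complex_simplicial G) (graph_complex_neq0 x).
Qed.

Lemma gscat_le_forest_cover m : connected_graph G ->
  forest_cover m.+1 -> gscat (graph_complex G) <= m.
Proof.
move=> conG /(forest_cover_gscat_cover conG); case: conG => /card_gt0P[x _] _.
by have [_] := gscatP (graph_complex_simplicial G) (graph_complex_neq0 x); apply.
Qed.

End Graphs.

(** * The staircase decomposition of a complete bipartite graph *)

Section Staircase.

Variables m k : nat.
Hypotheses (k_gt0 : 0 < k) (le_km : k <= m).

Definition ceil_slope e := (e * m + k.-1) %/ k.

(* Rows of class [c] are counted cyclically from its first row in column [0]. *)
Definition staircase_pos c i := (i + m - ceil_slope c) %% m.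

(** The row is represented by [staircase_pos c i + ceil_slope c]; the shift by [j] of the interval
    is moved to its side to avoid truncated subtraction. *)
Definition staircase c i j : bool :=
  ceil_slope (c + j) <= staircase_pos c i + j + ceil_slope c
  < ceil_slope (c + j).+1.

Lemma ceil_slope_le e y : (ceil_slope e <= y) = (e * m <= y * k).
Proof. by rewrite -ltnS /ceil_slope ltn_divLR // mulSn; apply/idP/idP; lia. Qed.

(** The slope [m / k] is at least 1 because [k <= m]. *)
Lemma ceil_slope_addl e d : ceil_slope e + d <= ceil_slope (e + d).
Proof.
have := leqnn (ceil_slope (e + d)); rewrite ceil_slope_le => H.
suff : ceil_slope e <= ceil_slope (e + d) - d.
  suff : d <= ceil_slope (e + d) by lia.
  rewrite leqNgt; apply/negP; nia.
rewrite ceil_slope_le; nia.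
Qed.

Lemma ceil_slope_period e w : ceil_slope (e + k * w) = ceil_slope e + m * w.
Proof.
rewrite /ceil_slope (_ : _ + _ = (m * w) * k + (e * m + k.-1)); last by nia.
by rewrite divnMDl // addnC.
Qed.

(** This makes the truncated subtraction in [staircase_pos] exact. *)
Lemma ceil_slope_lt_k c : c < k -> ceil_slope c <= m.
Proof. by rewrite ceil_slope_le; nia. Qed.

(** From one column to the next the ceiling grows by at least 1, which compensates the shift by [j];
    the intervals of two columns share at most an endpoint. *)
Lemma staircase_monotone c i j i' j' :
  staircase c i j -> staircase c i' j' -> j < j' ->
  staircase_pos c i <= staircase_pos c i'.
Proof.
move=> /andP[_ h1] /andP[h2 _] jj'.
have := ceil_slope_addl (c + j).+1 (j' - j.+1).
rewrite (_ : (c + j).+1 + (j' - j.+1) = c + j') ; lia.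
Qed.

Lemma staircase_pos_inj c i i' : c < k -> i < m -> i' < m ->
  staircase_pos c i = staircase_pos c i' -> i = i'.
Proof.
move=> /ceil_slope_lt_k ck im i'm /eqP.
rewrite /staircase_pos -!addnBA // eqn_modDr !modn_small //; exact: eqP.
Qed.

Variable n : nat.
Hypothesis le_mnk : m * n <= k * (m + n - 1).

(** The counting hypothesis [le_mnk] serves here to keep the staircase over [n] columns within [m]
    cyclic positions. *)
Lemma ceil_slope_add_n c : ceil_slope (c + n) <= ceil_slope c + m + n - 1.
Proof.
have := leqnn (ceil_slope c); rewrite !ceil_slope_le; nia.
Qed.

Lemma staircase_cover i j : i < m -> j < n -> exists2 c, c < k & staircase c i j.
Proof.
move=> im jn; have m_gt0 : 0 < m by lia.
(* Chosen so that [i + j] is at least [ceil_slope e] and less than [ceil_slope e.+1]. *)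
set e := ((i + j) * k) %/ m.
have te : ceil_slope e <= i + j by rewrite ceil_slope_le leq_divM.
have te1 : i + j < ceil_slope e.+1.
  by rewrite ltnNge ceil_slope_le -ltnNge mulnC -ltn_divLR // mulnC ltnS.
(* The class must satisfy [c + j = e] modulo [k]; the multiple [k * j] keeps the subtraction of [j]
   exact. *)
set N := e + k * j - j; set c := N %% k; set w := N %/ k.
have ck : c < k by rewrite ltn_mod.
have eN : c + j + k * w = e + k * j.
  have := divn_eq N k; rewrite -/c -/w /N; nia.
have t1 := ceil_slope_period (c + j) w; rewrite eN ceil_slope_period in t1.
have t2 := ceil_slope_period (c + j).+1 w.
rewrite addSn eN -addSn ceil_slope_period in t2.
have a1 := ceil_slope_addl c j.
have a2 := ceil_slope_addl (c + j).+1 (n - j.+1).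
rewrite (_ : (c + j).+1 + _ = c + n) in a2; last by lia.
have a3 := ceil_slope_add_n c; have a4 := ceil_slope_lt_k ck.
(* [Y] is the offset of row [i] from the first row of class [c], corrected by whole turns of length
   [m]. The bound [a1] makes it nonnegative, and [a2] with [a3] put it below [m], so it is the
   cyclic position. *)
set Y := i + m * j - m * w - ceil_slope c.
have EY : Y + ceil_slope c + m * w = i + m * j by rewrite /Y; lia.
have Ym : Y < m by lia.
exists c => //; rewrite /staircase; suff -> : staircase_pos c i = Y by lia.
rewrite /staircase_pos -(modn_small Ym); apply/eqP.
rewrite -(eqn_modDr (m * j)).
rewrite (_ : i + m - ceil_slope c + m * j = m * w.+1 + Y); last by rewrite mulnS; lia.
by rewrite (addnC Y) ![m * _]mulnC !modnMDl.
Qed.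

End Staircase.

(** * Joins *)

(** An injection preserves the sizes of vertex sets and of edge families, so the bound on [f @: S]
    passes to [S]. *)
Lemma forest_preimset (G H : sgraph) (f : G -> H) (F : {set {set H}}) :
  injective f -> forest F -> forest [set s in edge_set G | f @: s \in F].
Proof.
move=> f_inj /andP[_ /sparseP spF]; apply/andP; split.
  by apply/subsetP => s /setIdP[].
apply/sparseP => S S0; rewrite -(card_imset (mem S) f_inj).
apply: leq_ltn_trans (spF (f @: S) _); last first.
  by rewrite -card_gt0 card_imset // card_gt0.
rewrite /edge_count -(card_imset _ (imset_inj f_inj)).
apply/subset_leq_card/subsetP => _ /imsetP[s /setIdP[/setIdP[_ sF] sS] ->].
by rewrite inE sF imsetS.
Qed.

(** Meant for the inclusions of the two factors into the join. *)
Lemma forest_cover_hom (G H : sgraph) (f : G -> H) k : injective f ->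
  {homo f : x y / adj x y} -> forest_cover H k -> forest_cover G k.
Proof.
move=> f_inj f_hom [F [forF covF]].
exists (fun i => [set s in edge_set G | f @: s \in F i]).
split=> [i|s sE]; first exact: forest_preimset.
have fsE : f @: s \in edge_set H.
  case/edge_setP: sE => x [y [xy ->]]; apply/edge_setP; exists (f x), (f y).
  by rewrite f_hom // imsetU !imset_set1.
by have [i ik sF] := covF _ fsE; exists i; rewrite // inE sE.
Qed.

Section Join.

Variables G1 G2 : sgraph.
Local Notation J := (graph_join G1 G2).

Lemma inl_inj : injective (inl : G1 -> J). Proof. by move=> x y []. Qed.
Lemma inr_inj : injective (inr : G2 -> J). Proof. by move=> x y []. Qed.

Lemma graph_join_connected : 0 < #|G1| -> 0 < #|G2| -> connected_graph J.
Proof.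
move=> /card_gt0P[a _] /card_gt0P[b _]; split; first by apply/card_gt0P; exists (inl a).
have ab : connect (@adj J) (inl a) (inr b) by apply: connect1.
have ba : connect (@adj J) (inr b) (inl a) by apply: connect1.
have al z : connect (@adj J) (inl a) z.
  by case: z => z; [apply: connect_trans ab _|]; apply: connect1.
have la z : connect (@adj J) z (inl a).
  by case: z => z; [apply: connect_trans ba|]; apply: connect1.
by move=> x y; apply: connect_trans (al y).
Qed.

Lemma card_join_set (S : {set J}) :
  #|S| = #|[set x | (inl x : J) \in S]| + #|[set y | (inr y : J) \in S]|.
Proof.
rewrite -sum1_card big_sumType /= !sum1dep_card.
by congr (_ + _); apply: eq_card => x; rewrite !inE.
Qed.

Definition disjoint_union (F1 : {set {set G1}}) (F2 : {set {set G2}}) : {set {set J}} :=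
  [set inl @: (s : {set G1}) | s in F1] :|: [set inr @: (s : {set G2}) | s in F2].

Lemma forest_disjoint_union F1 F2 :
  forest F1 -> forest F2 -> forest (disjoint_union F1 F2).
Proof.
move=> /andP[FE1 sp1] /andP[FE2 sp2]; apply/andP; split.
  rewrite subUset; apply/andP; split; apply/subsetP => _ /imsetP[s sF ->].
    have /edge_setP[x [y [xy ->]]] := subsetP FE1 s sF; apply/edge_setP.
    by exists (inl x), (inl y); rewrite imsetU !imset_set1.
  have /edge_setP[x [y [xy ->]]] := subsetP FE2 s sF; apply/edge_setP.
  by exists (inr x), (inr y); rewrite imsetU !imset_set1.
apply/sparseP => S; rewrite -card_gt0 card_join_set.
set S1 := [set x | _]; set S2 := [set y | _] => S0.
have le12 : edge_count (disjoint_union F1 F2) S <= edge_count F1 S1 + edge_count F2 S2.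
  rewrite /edge_count -(card_imset (edges_in F1 S1) (imset_inj inl_inj)).
  rewrite -(card_imset (edges_in F2 S2) (imset_inj inr_inj)).
  apply: leq_trans (leq_card_setU _ _); apply/subset_leq_card/subsetP => s.
  case/setIdP; rewrite inE => /orP[]/imsetP[t tF ->] /subsetP tS; apply/setUP.
    by left; rewrite imset_f // inE tF; apply/subsetP => x xt; rewrite inE tS ?imset_f.
  by right; rewrite imset_f // inE tF; apply/subsetP => x xt; rewrite inE tS ?imset_f.
(* The bound with a predecessor also holds for an empty side; one side is nonempty, so the two
   bounds add up to less than [#|S1| + #|S2|]. *)
have bound (T : finType) (F : {set {set T}}) (A : {set T}) :
    two_uniform F -> sparse F -> edge_count F A <= #|A|.-1.
  move=> F2u /sparseP spF; have [->|/spF] := eqVneq A set0; last by case: #|A|.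
  by rewrite edge_count_small ?cards0.
have := bound _ _ S1 (edge_set_two_uniform FE1) sp1.
have := bound _ _ S2 (edge_set_two_uniform FE2) sp2.
lia.
Qed.

Definition cross_edges (R : G1 -> G2 -> bool) : {set {set J}} :=
  [set [set inl p.1; inr p.2] | p : G1 * G2 & R p.1 p.2].

Lemma cross_edgesP (R : G1 -> G2 -> bool) s :
  reflect (exists x y, R x y /\ s = [set inl x; inr y]) (s \in cross_edges R).
Proof.
apply: (iffP imsetP) => [[[x y] xy ->]|[x [y [xy ->]]]]; last by exists (x, y); rewrite ?inE.
by exists x, y; move: xy; rewrite inE.
Qed.

(* An edge maximizing [p x + q y] has an endpoint that lies on no other edge:
   edges [(x, y')] and [(x', y)] with [q y' < q y] and [p x' < p x] would
   violate monotonicity. *)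
Lemma monotone_forest (R : G1 -> G2 -> bool) (p : G1 -> nat) (q : G2 -> nat) :
  injective p -> injective q ->
  (forall x y x' y', R x y -> R x' y' -> q y < q y' -> p x <= p x') ->
  forest (cross_edges R).
Proof.
move=> p_inj q_inj mono.
have RE : cross_edges R \subset edge_set J.
  apply/subsetP => s /cross_edgesP[x [y [_ ->]]].
  by apply/edge_setP; exists (inl x), (inr y).
rewrite /forest RE; apply: sparse_degree; first exact: edge_set_two_uniform.
move=> S /set0Pn[v0 v0S].
pose P (e : G1 * G2) := [&& R e.1 e.2, (inl e.1 : J) \in S & (inr e.2 : J) \in S].
have edge_atP v s : s \in edges_at (cross_edges R) S v ->
    exists2 e, P e & s = [set inl e.1; inr e.2] /\ ((v == inl e.1) || (v == inr e.2)).
  case/setIdP => /setIdP[/cross_edgesP[x [y [xy ->]]]].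
  rewrite subUset !sub1set => /andP[xS yS]; rewrite !inE => v_e.
  by exists (x, y); rewrite // /P /= xy xS.
have degree1 v s0 : (forall s, s \in edges_at (cross_edges R) S v -> s = s0) ->
    degree (cross_edges R) S v <= 1.
  move=> H; rewrite -(cards1 s0); apply/subset_leq_card/subsetP => s /H ->.
  exact: set11.
have [[x1 y1] P1|P0] := pickP P; last first.
  exists v0 => //; apply: (degree1 _ set0) => s /edge_atP[e].
  by rewrite P0.
case: (@arg_maxnP _ (x1, y1) P (fun e => p e.1 + q e.2) P1) => -[x y] /= Pxy maxxy.
have /and3P[/= Rxy xS yS] := Pxy.
have [/existsP[y' /andP[Pxy' y'y]]|noy'] := boolP [exists y', P (x, y') && (y' != y)].
  exists (inr y) => //; apply: (degree1 _ [set inl x; inr y]) => s.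
  move=> /edge_atP[[x' y''] Pe /= [-> /= /eqP[yy]]]; subst y''.
  have := maxxy _ Pxy'; rewrite /= leq_add2l => qy'.
  have := maxxy _ Pe; rewrite /= leq_add2r => px'.
  have qy : q y' < q y.
    rewrite ltn_neqAle qy' andbT.
    by apply: contraNneq y'y => /q_inj->.
  have /and3P[/= Rxy' _ _] := Pxy'; have /and3P[/= Rx'y _ _] := Pe.
  suff -> : x' = x by [].
  by apply/p_inj/anti_leq; rewrite px' (mono _ _ _ _ Rxy' Rx'y qy).
exists (inl x) => //; apply: (degree1 _ [set inl x; inr y]) => s.
move=> /edge_atP[[x' y'] Pe /= [-> /orP[/eqP[xx]|//]]]; subst x'.
congr [set _; inr _]; apply/eqP; move/existsPn/(_ y'): noy'.
by rewrite Pe negbK.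
Qed.

(** Vertices of [G1] are rows and those of [G2] columns. Each class is monotone once rows are
    ordered by cyclic position, so [monotone_forest] applies. *)
Lemma cross_forest_cover k : 0 < k -> k <= #|G1| ->
  #|G1| * #|G2| <= k * (#|G1| + #|G2| - 1) ->
  exists F : nat -> {set {set J}}, (forall c, forest (F c)) /\
    forall x y, exists2 c, c < k & [set inl x; inr y] \in F c.
Proof.
move=> k0 km kmn; pose i (x : G1) := enum_rank x : nat; pose j (y : G2) := enum_rank y : nat.
(* The test [c < k] empties the classes from [k] on, which must be forests too. *)
pose F c := cross_edges (fun x y => (c < k) && staircase #|G1| k c (i x) (j y)).
exists F; split=> [c|x y].
  have [ck|ck] := ltnP c k; last first.
    rewrite /F (_ : cross_edges _ = set0); last first.
      by apply/setP => s; rewrite inE; apply/negP => /cross_edgesP[x [y []]]; rewrite ltnNge ck.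
    by rewrite /forest sub0set sparse_set0.
  apply: (@monotone_forest _ (fun x => staircase_pos #|G1| k c (i x)) j).
  - move=> x x' /(staircase_pos_inj k0 km ck (ltn_ord _) (ltn_ord _)) /val_inj.
    exact: enum_rank_inj.
  - by move=> y y' /val_inj/enum_rank_inj.
  - move=> x y x' y' /andP[_ h1] /andP[_ h2]; exact: (staircase_monotone k0 km h1 h2).
have [c ck hc] := staircase_cover k0 km kmn (ltn_ord (enum_rank x)) (ltn_ord (enum_rank y)).
by exists c => //; apply/cross_edgesP; exists x, y; rewrite ck.
Qed.

(** Below [maxn a1 a2] a forest of [G1] and one of [G2] share an index; the next [k] indices carry
    the cross edges. *)
Lemma forest_cover_join a1 a2 k :
  forest_cover G1 a1 -> forest_cover G2 a2 -> 0 < k -> k <= #|G1| ->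
  #|G1| * #|G2| <= k * (#|G1| + #|G2| - 1) ->
  forest_cover J (maxn a1 a2 + k).
Proof.
move=> [F1 [for1 cov1]] [F2 [for2 cov2]] k0 km kmn.
have [F [forF covF]] := cross_forest_cover k0 km kmn.
set a := maxn a1 a2.
exists (fun i => if i < a then disjoint_union (F1 i) (F2 i) else F (i - a)).
split=> [i|s /edge_setP[[x|x] [[y|y] [/= xy ->]]]].
- by case: ifP => _ //; apply: forest_disjoint_union.
- have [|i i1 sF] := cov1 [set x; y]; first by apply/edge_setP; exists x, y.
  exists i; first by rewrite /a; lia.
  rewrite (_ : i < a); last by rewrite /a; lia.
  by apply/setUP; left; apply/imsetP; exists [set x; y]; rewrite // imsetU !imset_set1.
- have [c ck sF] := covF x y; exists (a + c); first by lia.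
  by rewrite ltnNge leq_addr addKn.
- have [c ck sF] := covF y x; exists (a + c); first by lia.
  by rewrite ltnNge leq_addr addKn setUC.
- have [|i i2 sF] := cov2 [set x; y]; first by apply/edge_setP; exists x, y.
  exists i; first by rewrite /a; lia.
  rewrite (_ : i < a); last by rewrite /a; lia.
  by apply/setUP; right; apply/imsetP; exists [set x; y]; rewrite // imsetU !imset_set1.
Qed.

(** The cross edges lie in [k] forests, and sparsity on the full vertex set caps each at
    [#|G1| + #|G2| - 1] edges. *)
Lemma forest_cover_join_card k : 0 < #|G1| -> forest_cover J k ->
  #|G1| * #|G2| <= k * (#|G1| + #|G2| - 1).
Proof.
move=> G1_gt0 [F [forF covF]].
rewrite -card_prod -card_sum.
pose e (z : G1 * G2) : {set J} := [set inl z.1; inr z.2].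
have e_inj : injective e.
  move=> [x y] [x' y'] ez.
  have : inl x \in e (x', y') by rewrite -ez !inE eqxx.
  have : inr y \in e (x', y') by rewrite -ez !inE eqxx orbT.
  by rewrite !inE /= orbF => /eqP[->] /eqP[->].
rewrite -(card_imset predT e_inj).
have sub : e @: predT \subset \bigcup_(i < k) F i.
  apply/subsetP => _ /imsetP[[x y] _ ->].
  have [|i ik eF] := covF (e (x, y)); first by apply/edge_setP; exists (inl x), (inr y).
  by apply/bigcupP; exists (Ordinal ik).
apply: leq_trans (subset_leq_card sub) _.
apply: leq_trans (_ : \sum_(i < k) #|F i| <= _).
  elim/big_ind2: _ => [|A a B b hA hB|//]; first by rewrite cards0.
  by apply: leq_trans (leq_card_setU _ _) (leq_add hA hB).
rewrite -[X in _ <= X * _]card_ord -sum_nat_const leq_sum // => i _.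
have /andP[_ /sparseP/(_ setT)] := forF i.
have -> : edge_count (F i) [set: J] = #|F i|.
  by apply: eq_card => s; rewrite inE subsetT andbT.
rewrite -card_gt0 cardsT /= card_sum => /(_ _); lia.
Qed.

End Join.

(** The number [k] of staircase classes is left free here; it will be the ceiling, that is
    [B + 1]. *)
Lemma gscat_join_bounds (G1 G2 : sgraph) : connected_graph G1 -> connected_graph G2 ->
  let g1 := gscat (graph_complex G1) in
  let g2 := gscat (graph_complex G2) in
  let g := gscat (graph_complex (graph_join G1 G2)) in
  [/\ g1 <= g, g2 <= g, #|G1| * #|G2| <= g.+1 * (#|G1| + #|G2| - 1) &
      forall k, 0 < k -> k <= #|G1| ->
        #|G1| * #|G2| <= k * (#|G1| + #|G2| - 1) -> g <= g1 + g2 + k].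
Proof.
move=> con1 con2 g1 g2 g; have [[G1_gt0 _] [G2_gt0 _]] := (con1, con2).
have conJ := graph_join_connected G1_gt0 G2_gt0.
have covJ := forest_cover_gscat conJ.
split.
- apply: gscat_le_forest_cover => //.
  by apply: (forest_cover_hom (@inl_inj G1 G2)) covJ.
- apply: gscat_le_forest_cover => //.
  by apply: (forest_cover_hom (@inr_inj G1 G2)) covJ.
- exact: forest_cover_join_card.
move=> k k0 km kmn; apply: gscat_le_forest_cover => //.
have [F [forF covF]] := forest_cover_join (forest_cover_gscat con1) (forest_cover_gscat con2) k0 km kmn.
exists F; split=> // s /covF[i ik sF]; exists i => //; apply: leq_trans ik _.
(* This rests on [maxn g1.+1 g2.+1 <= (g1 + g2).+1]. *)
rewrite -/g1 -/g2; lia.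
Qed.

Import Order.TTheory GRing.Theory Num.Theory.

Theorem corollary24 (G1 G2 : sgraph) (n1 n2 : nat)
  (con1 : connected_graph G1) (con2 : connected_graph G2)
  (edge1 : has_edge G1) (edge2 : has_edge G2)
  (card1 : #|G1| = n1) (card2 : #|G2| = n2) :
  let B : int :=
    (Num.ceil ((n1%:R * n2%:R) / (n1%:R + n2%:R - 1) : rat) - 1)%R in
  let g1 : int := Posz (gscat (graph_complex G1)) in
  let g2 : int := Posz (gscat (graph_complex G2)) in
  let g : int := Posz (gscat (graph_complex (graph_join G1 G2))) in
  (Num.max (Num.max g1 g2) B <= g)%R /\ (g <= g1 + g2 + B + 1)%R.
Proof.
have [] := gscat_join_bounds con1 con2; rewrite card1 card2.
set g1 := gscat _; set g := gscat _; set g2 := gscat _ => g1g g2g lower upper B /=.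
have n1_gt0 : 0 < n1 by rewrite -card1; case: con1.
have n2_gt0 : 0 < n2 by rewrite -card2; case: con2.
have den : (n1%:R + n2%:R - 1 = (n1 + n2 - 1)%:R :> rat)%R.
  by rewrite natrB ?natrD //; lia.
have den_gt0 : (0 < (n1 + n2 - 1)%:R :> rat)%R by rewrite ltr0n; lia.
rewrite /B; set q := (_ / _ : rat)%R.
(* Bounds on the ceiling become the counting inequality between natural numbers. *)
have ceil_le k : (Num.ceil q <= Posz k)%R = (n1 * n2 <= k * (n1 + n2 - 1)).
  by rewrite ceil_le_int /q den ler_pdivrMr // -!natrM ler_nat.
have ceil_gt0 : (0 < Num.ceil q)%R.
  by rewrite ceil_gt0 /q den divr_gt0 // -natrM ltr0n muln_gt0 n1_gt0.
have lower' : (Num.ceil q <= Posz g.+1)%R by rewrite ceil_le.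
(* Positivity excludes a negative ceiling, so [B = k - 1] with [k] a positive natural number. *)
case E : (Num.ceil q) ceil_gt0 lower' => [k|//] k0 kg.
split; first by rewrite !ge_max; lia.
have : g <= g1 + g2 + k.
  apply: upper; first by lia.
    (* The ceiling is at most [n1] because [n2 <= n1 + n2 - 1]. *)
    suff : (Num.ceil q <= Posz n1)%R by rewrite E.
    by rewrite ceil_le leq_mul2l; lia.
  by rewrite -ceil_le E.
lia.
Qed.
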